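(* Let $y,t$ be formal variables. Then, as formal power series in $t$ with coefficients polynomial in $y$, $$\sum_{n\ge 1}\sum_{[\pi]\in\mathfrak{C}_n^o}y^{\operatorname{drop}_{eo}([\pi])}t^n = (y-1)t^2+ \sum_{m\ge 1}\frac{m!(m-1)!\,t^{2m}}{\prod_{k=1}^m \big(1+k(k+1)(1-y)t^2\big)}+\sum_{m\ge 1}\frac{\big((m-1)!\big)^2t^{2m-1}}{\prod_{k=1}^m \big(1+k(k-1)(1-y)t^2\big)}.$$
   Context: For $n\ge1$, a cycle on $[n]=\{1,\dots,n\}$ is an equivalence class $[\pi]$ of permutations $\pi=\pi_1\cdots\pi_n$ of $[n]$ (in one-line notation) under cyclic rotation of the entries; the set of cycles on $[n]$ is $\mathfrak{C}_n$. Each cycle is represented by the permutation $\pi$ with $\pi_1=1$, and indices are read modulo $n$ (so $\pi_{n+1}=\pi_1$). A drop of $[\pi]$ is a consecutive pair $(\pi_i,\pi_{i+1})$, $1\le i\le n$, with $\pi_i>\pi_{i+1}$; drops do not depend on the choice of rotation. By convention, the unique cycle $[(1)]\in\mathfrak{C}_1$ has exactly one drop $(\star,1)$, where $\star$ is considered neither even nor odd. A drop $(a,b)$ is odd-odd if $a$ and $b$ are both odd, and even-odd if $a$ is even and $b$ is odd. $\operatorname{drop}_{oo}([\pi])$ and $\operatorname{drop}_{eo}([\pi])$ denote the numbers of odd-odd and even-odd drops of $[\pi]$, respectively. Finally $\mathfrak{C}_n^o$ is the set of cycles $[\pi]\in\mathfrak{C}_n$ such that for every drop $(\pi_i,\pi_{i+1})$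 of $[\pi]$, the entry $\pi_{i+1}$ is odd. *)

(* Defs.v *)
From mathcomp Require Import all_boot all_order all_algebra all_fingroup.
Set Implicit Arguments. Unset Strict Implicit. Unset Printing Implicit Defensive.
Import GRing.Theory.
Local Open Scope ring_scope.

Definition fps := nat -> {poly int}.

Definition fps_of_poly (p : {poly {poly int}}) : fps := fun n => p`_n.

Definition fps_add (a b : fps) : fps := fun n => a n + b n.

Definition fps_mul (a b : fps) : fps :=
  fun n => \sum_(i < n.+1) a i * b (n - i)%N.

(* Multiplicative inverse, by the usual recursion
   b_0 = a_0^-1, b_n = - a_0^-1 * sum_{i<n} a_{n-i} b_i
   (meaningful when a_0 is a unit of Z[y]; all uses below have a_0 = 1). *)
Fixpoint fps_inv_upto (a : fps) (n : nat) : seq {poly int} :=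
  match n with
  | 0 => [:: (a 0%N)^-1]
  | n'.+1 =>
      let s := fps_inv_upto a n' in
      rcons s (- (a 0%N)^-1 * \sum_(i < n'.+1) a (n'.+1 - i)%N * nth 0 s i)
  end.
Definition fps_inv (a : fps) : fps := fun n => nth 0 (fps_inv_upto a n) n.

(* Infinite sum sum_{m>=1} F m, for a family where F m has t-adic valuation
   >= m - 1 (so only m <= n+1 contribute to the coefficient of t^n). *)
Definition fps_sum1 (F : nat -> fps) : fps :=
  fun n => \sum_(1 <= m < n.+2) F m n.

(* A cycle [pi] on [n] (n >= 1) is represented by its unique representative
   pi with pi_1 = 1.  We encode pi as s : 'S_n (positions and values shifted
   down by one): pi_{i+1} = (s i).+1, and the condition pi_1 = 1 is
   s ord0 = ord0.  Indices are read cyclically (ordS). *)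
Definition cval n (s : 'S_n) (i : 'I_n) : nat := (s i).+1.

Definition is_drop n (s : 'S_n) (i : 'I_n) : bool :=
  (cval s (ordS i) < cval s i)%N.

Definition in_Co n (s : 'S_n) : bool :=
  [forall i, is_drop s i ==> odd (cval s (ordS i))].

Definition drop_eo n (s : 'S_n) : nat :=
  #|[set i | [&& is_drop s i, ~~ odd (cval s i) & odd (cval s (ordS i))]]|.

Definition lhs_fps : fps := fun n =>
  match n with
  | 0 => 0
  | n'.+1 => \sum_(s : 'S_n'.+1 | (s ord0 == ord0) && in_Co s) 'X^(drop_eo s)
  end.

Definition yv : {poly int} := 'X.
Definition tv : {poly {poly int}} := 'X.

Definition rhs_term1 (m : nat) : fps :=
  fps_mul (fps_of_poly (((m`! * (m.-1)`!)%N)%:R%:P * tv ^+ (2 * m)))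
          (fps_inv (fps_of_poly
             (\prod_(1 <= k < m.+1) (1 + ((k * k.+1)%N%:R * (1 - yv))%:P * tv ^+ 2)))).

Definition rhs_term2 (m : nat) : fps :=
  fps_mul (fps_of_poly ((((m.-1)`! ^ 2)%N)%:R%:P * tv ^+ (2 * m).-1))
          (fps_inv (fps_of_poly
             (\prod_(1 <= k < m.+1) (1 + ((k * k.-1)%N%:R * (1 - yv))%:P * tv ^+ 2)))).

Definition rhs_fps : fps :=
  fps_add (fps_of_poly ((yv - 1)%:P * tv ^+ 2))
          (fps_add (fps_sum1 rhs_term1) (fps_sum1 rhs_term2)).

(* Main.v *)
(* Build a cycle on [n] from the one-letter cycle (n) by inserting n-1, ..., 1 in
   decreasing order.  If a variable u marks the gaps in which smaller letters
   will still be inserted, inserting a letter acts on the generating polynomial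
   by the derivation (1+u)^2 d/du when the letter is odd and u(1+yu) d/du when
   it is even; setting u = 0 at the end gives the coefficient of t^n.  In the
   coordinate v = u/(1+u) these derivations are d/dv and v(1-(1-y)v) d/dv, so
   their composite maps v^j to j^2 v^(j-1) - (1-y) j(j+1) v^j.  It is bidiagonal
   in the basis of the v^j, and the generating function of its powers is a sum of
   products of geometric series, which are the summands of the right-hand side.
   The even case comes out as y times a sum over prod_(k<m), and telescopes to
   the stated form with the correction (y-1) t^2. *)
Require Import Defs.
From mathcomp Require Import all_boot all_order all_algebra all_fingroup.
From mathcomp Require Import ring zify.
Set Implicit Arguments. Unset Strict Implicit. Unset Printing Implicit Defensive.
Import GRing.Theory.
Local Open Scope ring_scope.

(** * Enumerating permutations by insertion and by rotation *)

Lemma perm_permutations_cons (T : eqType) (x : T) (s : seq T) :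
  uniq (x :: s) ->
  perm_eq (permutations (x :: s))
    [seq take i w ++ x :: drop i w
       | w <- permutations s, i <- iota 0 (size s).+1].
Proof.
rewrite cons_uniq => /andP[xNs us]; apply: uniq_perm; first exact: permutations_uniq.
  apply: allpairs_uniq; rewrite ?permutations_uniq ?iota_uniq //.
  (* As [x] does not occur in [w], [rem] and [index] recover the pair [w], [i]; this makes insertion
     injective. *)
  have inv w i : w \in permutations s -> i \in iota 0 (size s).+1 ->
      rem x (take i w ++ x :: drop i w) = w
      /\ index x (take i w ++ x :: drop i w) = i.
    rewrite mem_permutations mem_iota => ws iw.
    have xNw : x \notin take i w.
      by apply: contra xNs => /mem_take; rewrite (perm_mem ws).
    have iws : size (take i w) = i.
      by rewrite size_take_min (perm_size ws); lia.
    split; last by rewrite index_cat (negPf xNw) /= eqxx iws addn0.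
    by rewrite -[RHS](cat_take_drop i w) remE index_cat (negPf xNw) /= eqxx
      addn0 take_size_cat // drop_cat ltnNge leqnSn /= subSnn /= drop0.
  move=> [w1 i1] [w2 i2] /allpairsPdep[a [b [aw bi [-> ->]]]].
  move=> /allpairsPdep[a' [b' [aw' bi' [-> ->]]]] /= e.
  have [e1 e2] := inv _ _ aw bi; have [e3 e4] := inv _ _ aw' bi'.
  by move: e1 e2; rewrite e e3 e4 => -> ->.
move=> v; rewrite mem_permutations; apply/idP/allpairsPdep => [vs|].
  have xv : x \in v by rewrite (perm_mem vs) mem_head.
  case/splitPr: xv vs => v1 v2 vs.
  have ps : perm_eq (v1 ++ v2) s by move: vs; rewrite -(cat1s x v2) perm_catCA perm_cons.
  exists (v1 ++ v2), (size v1); split.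
  - by rewrite mem_permutations.
  - by rewrite mem_iota /= -(perm_size ps) size_cat; lia.
  - by rewrite /= take_size_cat // drop_size_cat.
case=> [w [i [ws _ ->]]]; move: ws; rewrite mem_permutations => ws.
by rewrite -(cat1s x (drop i w)) perm_catCA perm_cons cat_take_drop.
Qed.

(** Rotating [b] to the front is a bijection, inverted by rotating [a] to the front. This moves the
    base letter of a cycle from 1 to the largest letter, where insertion starts. *)
Lemma big_permutations_head (T : eqType) (R : nmodType) (x0 a b : T)
    (s : seq T) (F : seq T -> R) :
  a \in s -> b \in s -> uniq s ->
  (forall k w, F (rot k w) = F w) ->
  \sum_(w <- permutations s | head x0 w == a) F w =
  \sum_(w <- permutations s | head x0 w == b) F w.
Proof.
move=> sa sb us Frot.
have rotP c d w : c \in s -> d \in s ->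
    w \in [seq w <- permutations s | head x0 w == c] ->
    rot (index d w) w \in [seq w <- permutations s | head x0 w == d]
    /\ rot (index c (rot (index d w) w)) (rot (index d w) w) = w.
  move=> sc sd; rewrite !mem_filter !mem_permutations => /andP[/eqP hw ws].
  have dw : d \in w by rewrite (perm_mem ws).
  have uw : uniq w by rewrite (perm_uniq ws).
  split; first by rewrite perm_rot ws andbT rot_index.
  case: w hw ws dw uw => // c' w /= <- _ dw /= /andP[cNw uw].
  case: (eqVneq c' d) => [->|cd]; first by rewrite !rot0 /= eqxx rot0.
  rewrite /rot /= index_cat.
  have -> : (c' \in drop (index d w) w) = false.
    by apply: contraNF cNw => /mem_drop.
  by rewrite /= eqxx addn0 drop_size_cat // take_size_cat //= cat_take_drop.
rewrite -big_filter -[RHS]big_filter.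
have E : perm_eq [seq w <- permutations s | head x0 w == b]
    [seq rot (index b w) w | w <- [seq w <- permutations s | head x0 w == a]].
  apply: uniq_perm; first by rewrite filter_uniq ?permutations_uniq.
    rewrite map_inj_in_uniq ?filter_uniq ?permutations_uniq //.
    move=> w1 w2 h1 h2 e.
    have [_ <-] := rotP a b w1 sa sb h1.
    by have [_ <-] := rotP a b w2 sa sb h2; rewrite e.
  move=> w; apply/idP/mapP => [h|[v h ->]].
    by have [h1 h2] := rotP b a w sb sa h; exists (rot (index a w) w).
  by have [] := rotP a b v sa sb h.
by rewrite (perm_big _ E) /= big_map; apply: eq_bigr => w _; rewrite Frot.
Qed.

Lemma big_permutations_cons (T : eqType) (R : nmodType) (x0 a : T)
    (s : seq T) (F : seq T -> R) :
  uniq (a :: s) ->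
  \sum_(w <- permutations (a :: s) | head x0 w == a) F w =
  \sum_(w <- permutations s) F (a :: w).
Proof.
move=> uas; rewrite -big_filter -(big_map (cons a) xpredT); apply: perm_big.
apply: uniq_perm; rewrite ?filter_uniq ?permutations_uniq //.
  by rewrite map_inj_uniq ?permutations_uniq // => w v [].
move=> w; rewrite mem_filter mem_permutations.
apply/andP/mapP => [[]|[v]]; last first.
  by rewrite mem_permutations => vs ->; rewrite /= eqxx perm_cons.
case: w => [|c w] /=; first by move=> _ /perm_size.
by move=> /eqP->; rewrite perm_cons => ws; exists w; rewrite ?mem_permutations.
Qed.

(** * Edge weights along paths and cyclic words *)

Fixpoint path_prod (T : Type) (R : comNzRingType) (G : T -> T -> R)
    (x : T) (s : seq T) : R :=
  if s is y :: s' then G x y * path_prod G y s' else 1.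

Definition cycle_prod (T : Type) (R : comNzRingType) (G : T -> T -> R)
    (w : seq T) : R :=
  if w is x :: s then path_prod G x (rcons s x) else 1.

Lemma path_prod_cat (T : Type) (R : comNzRingType) (G : T -> T -> R) x s1 s2 :
  path_prod G x (s1 ++ s2) = path_prod G x s1 * path_prod G (last x s1) s2.
Proof. by elim: s1 x => [|y s1 IH] x /=; rewrite ?mul1r // IH mulrA. Qed.

Lemma cycle_prod_rot (T : Type) (R : comNzRingType) (G : T -> T -> R) k w :
  cycle_prod G (rot k w) = cycle_prod G w.
Proof.
rewrite -{2}(cat_take_drop k w) /rot.
case: (take k w) (drop k w) => [|x s1] [|y s2]; rewrite ?cats0 //=.
by rewrite !rcons_cat /= !path_prod_cat /= -!cats1 !path_prod_cat /=; ring.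
Qed.

Lemma path_prodE (T : Type) (R : comNzRingType) (G : T -> T -> R) x0 x s :
  path_prod G x s =
  \prod_(i < size s) G (nth x0 (x :: s) i) (nth x0 s i).
Proof.
elim: s x => [|y s IH] x /=; first by rewrite big_ord0.
by rewrite big_ord_recl /= IH.
Qed.

Lemma cycle_prodE (T : Type) (R : comNzRingType) (G : T -> T -> R) n
    (f : 'I_n -> T) :
  cycle_prod G [seq f i | i <- enum 'I_n] = \prod_i G (f i) (f (ordS i)).
Proof.
case: n f => [|n] f; first by rewrite big_ord0 enum_ord0.
rewrite enum_ordSl /= (path_prodE _ (f ord0)) size_rcons size_map size_map.
rewrite -cardE card_ord; apply: eq_bigr => i _.
congr (G _ _).
  rewrite -rcons_cons -map_cons -enum_ordSl nth_rcons size_map size_enum_ord.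
  by rewrite ltn_ord (nth_map ord0) ?size_enum_ord // nth_ord_enum.
rewrite nth_rcons -map_comp size_map -cardE card_ord.
case: (ltngtP i n) => [lt_in|lt_ni|eq_in].
- rewrite (nth_map (Ordinal lt_in)) ?size_enum_ord //=; congr f; apply/val_inj.
  by rewrite /= nth_enum_ord // /bump modn_small.
- by have := ltn_ord i; rewrite ltnS leqNgt lt_ni.
- by congr f; apply/val_inj; rewrite /= eq_in modnn.
Qed.

Lemma big_perm_words (n : nat) (R : nmodType) (F : seq nat -> R) :
  \sum_(s : 'S_n.+1 | s ord0 == ord0) F [seq cval s i | i <- enum 'I_n.+1] =
  \sum_(w <- permutations (iota 1 n.+1) | head 0%N w == 1%N) F w.
Proof.
pose word (s : 'S_n.+1) := [seq cval s i | i <- enum 'I_n.+1].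
have word_inj : injective word.
  move=> s1 s2 /eq_in_map e; apply/permP => i.
  by have [/val_inj] := e i (mem_enum _ i).
have iotaE : iota 1 n.+1 = [seq (val i).+1 | i <- enum 'I_n.+1].
  by rewrite (map_comp succn val) val_enum_ord (iotaDl 1 0).
have uw : uniq (map word (enum 'S_n.+1)) by rewrite map_inj_uniq ?enum_uniq.
have sub : {subset map word (enum 'S_n.+1) <= permutations (iota 1 n.+1)}.
  move=> w /mapP[s _ ->]; rewrite mem_permutations iotaE.
  rewrite /word (map_comp (fun i : 'I_n.+1 => (val i).+1) s); apply: perm_map.
  apply: uniq_perm; first by rewrite map_inj_uniq ?enum_uniq //; apply: perm_inj.
    exact: enum_uniq.
  move=> i; rewrite mem_enum; apply/mapP; exists (s^-1%g i).
    by rewrite mem_enum.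
  by rewrite permKV.
(* Both lists have (n+1)! distinct entries, so the inclusion [sub] is an equality of sets. *)
have sz : (size (permutations (iota 1 n.+1)) <= size (map word (enum 'S_n.+1)))%N.
  by rewrite size_permutations ?iota_uniq // size_iota size_map -cardE card_Sn.
have [_ E] := uniq_min_size uw sub sz.
have {E} E := uniq_perm (permutations_uniq _) uw (fsym E).
rewrite (perm_big _ E) /= big_map big_enum_cond /=; apply: eq_bigl => s.
by rewrite /word enum_ordSl /= /cval eqSS -val_eqE.
Qed.

(** * Insertion operators and their commutation relations *)

(* The insertion of a new minimal letter consumes one reserved gap (hence the
   derivative) and creates one gap on each side of the new letter; [l] weighs
   leaving the left gap closed, [r] reserving the right one. *)
Definition insert_op (R : comNzRingType) (l r : R) (p : {poly R}) : {poly R} :=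
  (l%:P + 'X) * (1%:P + r%:P * 'X) * p^`().

Definition odd_op (R : comNzRingType) : {poly R} -> {poly R} := insert_op 1 1.

Definition even_op (R : comNzRingType) (y : R) : {poly R} -> {poly R} :=
  insert_op 0 y.

(* The commutator of [odd_op] and [even_op y]; together the three operators
   satisfy the sl2 relations up to scaling by [1 - y]. *)
Definition bracket_op (R : comNzRingType) (y : R) (p : {poly R}) : {poly R} :=
  (1%:P + 'X) * (1%:P + (2 * y - 1)%:P * 'X) * p^`().

Lemma odd_op_even_op (R : comNzRingType) (y : R) p :
  odd_op (even_op y p) = even_op y (odd_op p) + bracket_op y p.
Proof.
rewrite /odd_op /even_op /bracket_op /insert_op !(derivM, derivD, derivC, derivX).
move: (p^`())^`() (p^`()) => p2 p1.
rewrite polyCB polyCM !polyC1 polyC0 polyCMn polyC1; ring.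
Qed.

Lemma odd_op_bracket_op (R : comNzRingType) (y : R) p :
  odd_op (bracket_op y p) = bracket_op y (odd_op p) - (2 * (1 - y)) *: odd_op p.
Proof.
rewrite /odd_op /even_op /bracket_op /insert_op !(derivM, derivD, derivC, derivX).
move: (p^`())^`() (p^`()) => p2 p1.
rewrite -mul_polyC !(polyCB,polyCM) !polyC1 polyCMn polyC1; ring.
Qed.

(** Moving [even_op y] past [j.+1] copies of [odd_op] stops at the second commutator, itself a
    multiple of [odd_op]; [j.+1 * j] is twice the number of pairs of copies. *)
Lemma iter_odd_op_even_op (R : comNzRingType) (y : R) j p :
  iter j.+1 (@odd_op R) (even_op y p) =
  even_op y (iter j.+1 (@odd_op R) p)
  + bracket_op y (iter j (@odd_op R) p) *+ j.+1
  - ((1 - y) *: iter j (@odd_op R) p) *+ (j.+1 * j).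
Proof.
have oddD (f g : {poly R}) : odd_op (f + g) = odd_op f + odd_op g.
  by rewrite /odd_op /insert_op derivD mulrDr.
have oddN (f : {poly R}) : odd_op (- f) = - odd_op f.
  by rewrite /odd_op /insert_op derivN mulrN.
have oddMn (f : {poly R}) m : odd_op (f *+ m) = odd_op f *+ m.
  by rewrite /odd_op /insert_op derivMn mulrnAr.
have oddZ a (f : {poly R}) : odd_op (a *: f) = a *: odd_op f.
  by rewrite /odd_op /insert_op derivZ scalerAr.
elim: j => [|j IH]; first by rewrite /= odd_op_even_op muln0 mulr0n subr0.
rewrite iterS {}IH !(oddD, oddN, oddMn, oddZ) odd_op_even_op odd_op_bracket_op.
rewrite -!iterS [iter j.+2 _ _]iterS; move: (iter j.+1 _ p) => f.
rewrite -!scaler_nat !natrM -[j.+2%:R]natr1 -[j.+1%:R]natr1.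
rewrite -!mul_polyC; move: (j%:R) => {}j.
rewrite !(polyCB, polyCM, polyCD, polyC1, polyCMn); ring.
Qed.

Lemma horner0_odd_op (R : comNzRingType) (p : {poly R}) :
  (odd_op p).[0] = p^`().[0].
Proof. by rewrite /odd_op /insert_op !hornerE; ring. Qed.

(* In the coordinate [v = u / (1 + u)] one has [odd_op = d/dv], so this is [j!]
   times the coefficient of [v^j] in [p]. *)
Definition odd_moment (R : comNzRingType) (j : nat) (p : {poly R}) : R :=
  (iter j (@odd_op R) p).[0].

Lemma odd_moment_odd_op (R : comNzRingType) j (p : {poly R}) :
  odd_moment j (odd_op p) = odd_moment j.+1 p.
Proof. by rewrite /odd_moment iterSr. Qed.

(** At 0, [even_op] vanishes through its factor ['X], while [bracket_op] and [odd_op] both reduce to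
    the derivative. *)
Lemma odd_moment_even_op (R : comNzRingType) (y : R) j p :
  odd_moment j.+1 (even_op y p) =
  odd_moment j.+1 p *+ j.+1 - ((1 - y) * odd_moment j p) *+ (j.+1 * j).
Proof.
rewrite /odd_moment iter_odd_op_even_op [in RHS]iterS horner0_odd_op.
move: (iter j.+1 _ p) (iter j _ p) => f g.
rewrite /even_op /bracket_op /insert_op !hornerE !hornerMn !hornerE; ring.
Qed.

(** In the coordinate v, 1 + u is 1/(1-v), whose j-th derivative is j!/(1-v)^(j+1). *)
Lemma odd_moment_1DX (R : comNzRingType) j :
  odd_moment j (1%:P + 'X : {poly R}) = j`!%:R.
Proof.
rewrite /odd_moment.
have -> : iter j (@odd_op R) (1%:P + 'X) = j`!%:R *: (1%:P + 'X) ^+ j.+1.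
  elim: j => [|j IH]; first by rewrite scale1r.
  rewrite iterS IH /odd_op /insert_op derivZ deriv_exp derivD derivC derivX.
  rewrite add0r !mul1r -scaler_nat factS natrM mulrC !exprS /=.
  move: (j.+1%:R : R) (j`!%:R : R) (_ ^+ j) => a b p.
  by rewrite -!mul_polyC polyCM; ring.
by rewrite hornerZ horner_exp !hornerE expr1n mulr1.
Qed.

Lemma odd_momentZ (R : comNzRingType) (a : R) j (p : {poly R}) :
  odd_moment j (a *: p) = a * odd_moment j p.
Proof.
rewrite /odd_moment -hornerZ; congr horner.
by elim: j => //= j ->; rewrite /odd_op /insert_op derivZ scalerAr.
Qed.

(** * Letter insertion as a derivation *)

(** Inserting [c] into a gap replaces its factor [G a b] by a multiple of the derivative, so the sum
    over gaps is the Leibniz rule. The position after the last letter is left out because, for a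
    cycle, [s] ends with the closing copy of the head. *)
Lemma path_prod_insert (R : comNzRingType) (G : nat -> nat -> {poly R})
    (c : nat) (l r : R) (x : nat) (s : seq nat) :
  (forall a b, (c < a)%N -> (c < b)%N ->
    G a c * G c b = (l%:P + 'X) * (1%:P + r%:P * 'X) * (G a b)^`()) ->
  (c < x)%N -> all (ltn c) s ->
  \sum_(i <- iota 0 (size s)) path_prod G x (take i s ++ c :: drop i s) =
  insert_op l r (path_prod G x s).
Proof.
move=> Gc; elim: s x => [|y s IH] x cx /=.
  by rewrite big_nil /insert_op derivC mulr0.
case/andP=> cy cs; rewrite big_cons (iotaDl 1 0) big_map -big_distrr /= IH //.
by rewrite mulrA Gc // /insert_op derivM; ring.
Qed.

(** [foldr] applies the operator of the first letter last; with [s] sorted, each inserted letter is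
    thus smaller than those present, as [Gc] requires. *)
Lemma sum_cycle_prod_insert (R : comNzRingType) (G : nat -> nat -> {poly R})
    (l r : nat -> R) (x : nat) (s : seq nat) :
  (forall a b c, (c < a)%N -> (c < b)%N ->
    G a c * G c b = ((l c)%:P + 'X) * (1%:P + (r c)%:P * 'X) * (G a b)^`()) ->
  sorted ltn s -> all (gtn x) s ->
  \sum_(w <- permutations s) cycle_prod G (x :: w) =
  foldr (fun c => insert_op (l c) (r c)) (G x x) s.
Proof.
move=> Gc; elim: s => [|c s IH] /=.
  by rewrite big_seq1 /= mulr1.
move=> pcs /andP[cx sx].
have ucs : uniq (c :: s) by apply: (sorted_uniq ltn_trans ltnn).
rewrite -IH ?(path_sorted pcs) // (perm_big _ (perm_permutations_cons ucs)).
rewrite big_allpairs_dep /insert_op raddf_sum mulr_sumr; apply: eq_big_seq => w.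
rewrite mem_permutations => ws.
rewrite -[RHS](path_prod_insert (fun a b => @Gc a b c)) //; last first.
  rewrite all_rcons (perm_all _ ws) /= cx.
  exact: (order_path_min ltn_trans pcs).
rewrite size_rcons (perm_size ws); apply: eq_big_seq => i.
rewrite mem_iota add0n ltnS -(perm_size ws) => /andP[_ iw].
by rewrite drop_rcons // -[in RHS]cats1 takel_cat //= rcons_cat.
Qed.

(** * Drop statistics as edge weights *)

(* Each gap of a cyclic word in the letters larger than the next letter to be
   inserted is either closed (contributing [drop_weight]) or reserved for smaller
   letters; a reserved gap after [a] is marked by the variable of the outer
   polynomial ring, and already makes [a] a drop top. *)
Definition drop_weight (a b : nat) : {poly int} :=
  ((b < a)%N ==> odd b)%:R * 'X ^+ [&& b < a, ~~ odd a & odd b]%N.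

Definition top_weight (a : nat) : {poly int} := if odd a then 1 else 'X.

Definition slot_weight (a b : nat) : {poly {poly int}} :=
  (drop_weight a b)%:P + (top_weight a)%:P * 'X.

(** The pair (a, c) is a drop and (c, b) is not. Hence [slot_weight a c] is [top_weight a] times the
    factor in [odd c], and [top_weight a] is the derivative of [slot_weight a b]. *)
Lemma slot_weight_min a b c : (c < a)%N -> (c < b)%N ->
  slot_weight a c * slot_weight c b =
  ((odd c)%:R%:P + 'X) * (1%:P + (top_weight c)%:P * 'X) * (slot_weight a b)^`().
Proof.
move=> ca cb; rewrite /slot_weight !(derivD, derivM, derivC, derivX).
rewrite /drop_weight ca ltnNge (ltnW cb) /= expr0 mulr1 /top_weight.
by case: (odd c); case: (odd a); rewrite /= ?(expr0, expr1, polyC0, polyC1); ring.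
Qed.

(** Evaluation at 0 closes every gap and leaves [drop_weight] on each edge; their product is zero
    unless [in_Co] holds, and then records [drop_eo]. *)
Lemma lhs_fps_insert n :
  lhs_fps n.+1 =
  (foldr (fun c => insert_op (odd c)%:R (top_weight c))
     (slot_weight n.+1 n.+1) (iota 1 n)).[0].
Proof.
have horner0 w : (cycle_prod slot_weight w).[0] = cycle_prod drop_weight w.
  case: w => [|x s]; first by rewrite /= -polyC1 hornerC.
  rewrite /cycle_prod; move: (rcons s x) => {}s.
  elim: s x => [|y s IH] x /=; first by rewrite -polyC1 hornerC.
  by rewrite hornerM IH /slot_weight hornerD hornerM hornerX !hornerC mulr0 addr0.
transitivity (\sum_(s : 'S_n.+1 | s ord0 == ord0)
    cycle_prod drop_weight [seq cval s i | i <- enum 'I_n.+1]).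
  rewrite /= [LHS]big_mkcondr; apply: eq_bigr => s _.
  rewrite cycle_prodE /drop_weight big_split /=.
  have -> : \prod_(i < n.+1) (is_drop s i ==> odd (cval s (ordS i)))%:R
      = (in_Co s)%:R :> {poly int}.
    rewrite /in_Co; case: forallP => [h|/forallP]; first by rewrite big1 // => i; rewrite h.
    rewrite negb_forall => /existsP[i /negPf hi].
    by rewrite (bigD1 i) //= hi mul0r.
  case: (in_Co s); rewrite ?mul0r ?mul1r //.
  rewrite -expr_sum /drop_eo -sum1dep_card big_mkcond /=.
  by congr ('X ^+ _); apply: eq_bigr => i _; rewrite /is_drop; case: ifP.
rewrite big_perm_words.
rewrite (@big_permutations_head _ _ 0%N 1%N n.+1); last first.
- by move=> k w; rewrite cycle_prod_rot.
- exact: iota_uniq.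
- by rewrite mem_iota; lia.
- by rewrite mem_iota; lia.
have pn : perm_eq (iota 1 n.+1) (n.+1 :: iota 1 n).
  have -> : iota 1 n.+1 = rcons (iota 1 n) n.+1.
    by rewrite -cats1 -[n.+1 in LHS]addn1 iotaD.
  by rewrite perm_rcons.
rewrite -big_filter (perm_big [seq w <- permutations (n.+1 :: iota 1 n)
   | head 0%N w == n.+1]); last first.
  exact/perm_filter/perm_permutations.
rewrite big_filter big_permutations_cons; last first.
  by rewrite -(perm_uniq pn) iota_uniq.
rewrite -(sum_cycle_prod_insert slot_weight_min) ?iota_ltn_sorted //; last first.
  by apply/allP => i; rewrite mem_iota /=; lia.
by rewrite horner_sum; apply: eq_bigr => w _; rewrite -horner0.
Qed.

(** * Power series in t: truncation and inversion *)

Lemma fps_mul_coef (p : {poly {poly int}}) (b : fps) n N : (n <= N)%N ->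
  fps_mul (fps_of_poly p) b n = (p * \poly_(i < N.+1) b i)`_n.
Proof.
move=> nN; rewrite coefM; apply: eq_bigr => i _; congr (_ * _).
by rewrite coef_poly ltnS (leq_trans (leq_subr _ _) nN).
Qed.

Lemma fps_mul_polyM (p q : {poly {poly int}}) (b : fps) n :
  fps_mul (fps_of_poly (p * q)) b n =
  fps_mul (fps_of_poly p) (fps_mul (fps_of_poly q) b) n.
Proof.
rewrite (fps_mul_coef _ _ (leqnn n)) -mulrA coefM; apply: eq_bigr => i _.
by rewrite [in RHS](@fps_mul_coef _ _ _ n) ?leq_subr.
Qed.

Lemma fps_mul_CXn (c : {poly int}) d (b : fps) n :
  fps_mul (fps_of_poly (c%:P * 'X^d)) b n =
  if (n < d)%N then 0 else c * b (n - d)%N.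
Proof.
rewrite (fps_mul_coef _ _ (leqnn n)) -mulrA coefCM coefXnM.
by case: ifP => _; rewrite ?mulr0 // coef_poly ltnS leq_subr.
Qed.

Lemma eq_fps_mul (p : {poly {poly int}}) (a b : fps) n :
  a =1 b -> fps_mul (fps_of_poly p) a n = fps_mul (fps_of_poly p) b n.
Proof. by move=> ab; apply: eq_bigr => i _; rewrite ab. Qed.

Lemma fps_inv_unique (a b : fps) : a 0%N = 1 ->
  (forall n, fps_mul a b n = (n == 0%N)%:R) -> fps_inv a =1 b.
Proof.
move=> a0 ab n.
have E m : fps_inv_upto a m = mkseq b m.+1.
  elim: m => [|m IH].
    by have := ab 0%N; rewrite /mkseq /= /fps_mul big_ord1 a0 invr1 mul1r subn0 => ->.
  rewrite [LHS]/= IH [RHS]mkseqS; congr (rcons _ _).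
  have := ab m.+1; rewrite /fps_mul big_ord_recl a0 mul1r subn0 /= => /eqP.
  rewrite addr_eq0 => /eqP->; rewrite invr1 mulN1r; congr (- _).
  rewrite (reindex_inj rev_ord_inj); apply: eq_bigr => i _ /=.
  rewrite nth_mkseq; last by rewrite subSS ltnS leq_subr.
  by congr (a _ * b _); rewrite /bump /=; have := ltn_ord i; lia.
by rewrite /fps_inv E nth_mkseq.
Qed.

(** Coefficients in z of 1 / prod_(1 <= k <= m) (1 + c_k z), that is, the complete homogeneous
    symmetric polynomials in the -c_k. *)
Fixpoint inv_series (c : nat -> {poly int}) (m : nat) : fps :=
  if m is m'.+1 then
    fix coefs i :=
      if i is i'.+1 then inv_series c m' i'.+1 - c m'.+1 * coefs i'
      else inv_series c m' 0
  else fun i => (i == 0%N)%:R.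

Arguments inv_series : simpl never.

Lemma inv_seriesS (c : nat -> {poly int}) m i :
  inv_series c m.+1 i.+1 = inv_series c m i.+1 - c m.+1 * inv_series c m.+1 i.
Proof. by []. Qed.

Lemma inv_series0 (c : nat -> {poly int}) m : inv_series c m 0 = 1.
Proof. by elim: m. Qed.

Lemma eq_inv_series (c d : nat -> {poly int}) m :
  (forall k, c k.+1 = d k.+1) -> inv_series c m =1 inv_series d m.
Proof.
move=> cd; elim: m => // m IH i; elim: i => [|i IHi]; first exact: IH.
by rewrite !inv_seriesS IH cd IHi.
Qed.

(** The first factor is 1. This turns the products over k(k-1) of the second sum into products over
    k(k+1). *)
Lemma inv_series_shift (c : nat -> {poly int}) m :
  c 1%N = 0 -> inv_series c m.+1 =1 inv_series (fun k => c k.+1) m.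
Proof.
move=> c1; elim: m => [|m IH] i.
  by case: i => // i; rewrite inv_seriesS c1 mul0r subr0.
by elim: i => [|i IHi]; rewrite ?inv_series0 // inv_seriesS IH IHi.
Qed.

Lemma fps_inv_prod (c : nat -> {poly int}) m n :
  fps_inv (fps_of_poly (\prod_(1 <= k < m.+1) (1 + (c k)%:P * 'X ^+ 2))) n =
  if odd n then 0 else inv_series c m n./2.
Proof.
rewrite (@fps_inv_unique _ (fun n => if odd n then 0 else inv_series c m n./2)) //.
  rewrite /fps_of_poly -horner_coef0 horner_prod big1 // => k _.
  by rewrite hornerD hornerM hornerXn expr0n mulr0 addr0 -polyC1 hornerC.
elim: m => [|m IH] {}n.
  have := fps_mul_CXn 1 0 (fun n => if odd n then 0 else (n./2 == 0%N)%:R) n.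
  rewrite big_geq // polyC1 mulr1 => ->; rewrite mul1r subn0.
  by case: n => [|[|n]] //=; case: (odd n).
rewrite big_nat_recr //= fps_mul_polyM -IH; apply: eq_fps_mul => {}n.
rewrite (fps_mul_coef _ _ (leqnn n)) mulrDl mul1r coefD -(fps_mul_coef _ _ (leqnn n)).
rewrite fps_mul_CXn coef_poly ltnSn.
case: n => [|[|n]]; rewrite ?addr0 ?subn0 //= !subSS subn0 negbK.
by case: (odd n); rewrite ?mulr0 ?addr0 // subrK.
Qed.

(** * Coefficients of the left-hand side *)

(** This serves twice: for the induction on the operator power, and for the telescoping of the even
    case. *)
Lemma sum_inv_seriesS (c : nat -> {poly int}) N (a : nat -> {poly int}) :
  \sum_(j < N.+1) inv_series c j.+1 (N - j)%N * a j =
  \sum_(j < N.+1) inv_series c j (N - j)%N * a j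
  - \sum_(j < N) c j.+1 * inv_series c j.+1 (N - j.+1)%N * a j.
Proof.
rewrite !big_ord_recr /= subnn !inv_series0 addrAC; congr (_ + _).
rewrite -sumrB; apply: eq_bigr => j _.
by rewrite -(@subnSK j N) // inv_seriesS; ring.
Qed.

(* With [z = t^2], [1 / prod_(k <= j) (1 + pole k * z)] is the transfer series of
   [iter_odd_even_coef], up to the factor [j! z^j]. *)
Definition pole (k : nat) : {poly int} := (k * k.+1)%N%:R * (1 - yv).

Lemma iter_odd_even_coef N p :
  (iter N (fun r => odd_op (even_op yv r)) p).[0] =
  \sum_(j < N.+1) inv_series pole j (N - j)%N * (j`!%:R * odd_moment j p).
Proof.
elim: N p => [|N IH] p; first by rewrite big_ord1 /= !mul1r.
rewrite iterSr IH [RHS]big_ord_recl.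
(* The empty product is the series 1, whose coefficient at the positive index N+1 is zero. *)
rewrite [inv_series _ ord0 _](_ : _ = 0) // mul0r add0r.
under [RHS]eq_bigr => j _ do rewrite lift0 subSS.
rewrite (@sum_inv_seriesS _ _ (fun j => j.+1`!%:R * odd_moment j.+1 p)).
under eq_bigr => j _ do
  rewrite odd_moment_odd_op odd_moment_even_op mulrBr mulrBr.
rewrite sumrB; congr (_ - _).
  by apply: eq_bigr => j _; rewrite factS natrM -mulr_natl; ring.
rewrite big_ord_recl muln0 mulr0n !mulr0 add0r; apply: eq_bigr => j _.
by rewrite lift0 /pole mulnC -mulr_natl; ring.
Qed.

Lemma foldr_insert_op N k p :
  foldr (fun c => insert_op (odd c)%:R (top_weight c)) p (iota k.*2.+1 N.*2) =
  iter N (fun r => odd_op (even_op yv r)) p.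
Proof.
elim: N k => //= N IH k.
by rewrite -doubleS IH /top_weight /= negbK odd_double.
Qed.

Lemma lhs_fps_odd N :
  lhs_fps N.*2.+1 = \sum_(j < N.+1) inv_series pole j (N - j)%N * (j`! ^ 2)%N%:R.
Proof.
rewrite lhs_fps_insert (foldr_insert_op _ 0) iter_odd_even_coef.
have -> : slot_weight N.*2.+1 N.*2.+1 = 1%:P + 'X.
  rewrite /slot_weight /drop_weight /top_weight ltnn /= odd_double.
  by rewrite expr0 mulr1 mul1r.
by apply: eq_bigr => j _; rewrite odd_moment_1DX -natrM.
Qed.

Lemma lhs_fps_even N :
  lhs_fps N.*2.+2 =
  yv * \sum_(j < N.+1) inv_series pole j (N - j)%N * (j`! * j.+1`!)%N%:R.
Proof.
rewrite lhs_fps_insert.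
have -> : iota 1 N.*2.+1 = iota 1 N.*2 ++ [:: N.*2.+1].
  by rewrite -[N.*2.+1 in LHS]addn1 iotaD.
rewrite foldr_cat (foldr_insert_op _ 0) /=.
rewrite odd_double iter_odd_even_coef mulr_sumr.
(* The operator sees only the derivative, so the initial weight 1 + yu acts as y(1 + u). *)
have -> : insert_op (~~ false)%:R (top_weight N.*2.+1) (slot_weight N.*2.+2 N.*2.+2)
    = yv *: odd_op (1%:P + 'X).
  rewrite /slot_weight /top_weight /= odd_double /= /odd_op /insert_op.
  by rewrite !(derivD, derivM, derivC, derivX) -mul_polyC; ring.
apply: eq_bigr => j _; rewrite odd_momentZ odd_moment_odd_op odd_moment_1DX natrM.
by ring.
Qed.

(** * Coefficients of the right-hand side and comparison *)

Lemma rhs_term1E j n :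
  rhs_term1 j.+1 n =
  if odd n || (n < j.*2.+2)%N then 0
  else inv_series pole j.+1 (n - j.*2.+2)%N./2 * (j`! * j.+1`!)%N%:R.
Proof.
rewrite /rhs_term1 fps_mul_CXn (fps_inv_prod pole) mul2n doubleS mulrC mulnC.
case: ltnP => [_|le]; rewrite ?orbT ?orbF //.
by rewrite oddB //= odd_double addbF; case: (odd n); rewrite ?mul0r.
Qed.

Lemma rhs_term2E j n :
  rhs_term2 j.+1 n =
  if ~~ odd n || (n < j.*2.+1)%N then 0
  else inv_series pole j (n - j.*2.+1)%N./2 * (j`! ^ 2)%N%:R.
Proof.
rewrite /rhs_term2 fps_mul_CXn mul2n doubleS /= mulrC.
rewrite (fps_inv_prod (fun k => (k * k.-1)%N%:R * (1 - yv))).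
rewrite inv_series_shift ?mul0r // (@eq_inv_series _ pole); last first.
  by move=> k; rewrite /pole /= mulnC.
case: ltnP => [_|le]; rewrite ?orbT ?orbF //.
by rewrite oddB //= odd_double addbT; case: (odd n); rewrite ?mul0r.
Qed.

Theorem theorem1p4 : forall n : nat, lhs_fps n = rhs_fps n.
Proof.
have trunc (F : nat -> {poly int}) M N : (N <= M)%N ->
    (forall j, (N <= j)%N -> F j = 0) ->
    \sum_(0 <= j < M) F j = \sum_(j < N) F j.
  move=> NM F0; rewrite (@big_cat_nat _ _ _ N) //=.
  rewrite [X in _ + X]big_nat_cond [X in _ + X]big1 ?addr0 ?big_mkord // => j.
  by rewrite andbT => /andP[/F0].
have sumE (p F G : nat -> fps) n :
    fps_add (p 0%N) (fps_add (fps_sum1 F) (fps_sum1 G)) n =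
    p 0%N n + (\sum_(0 <= j < n.+1) F j.+1 n + \sum_(0 <= j < n.+1) G j.+1 n).
  by rewrite /fps_add /fps_sum1 !big_add1.
move=> n; rewrite [RHS](sumE (fun=> _)).
rewrite coefCM coefXn.
have [N [->|->]] : exists N, n = N.*2.+1 \/ n = N.*2.
- by exists n./2; have := odd_double_half n; case: (odd n); [left|right].
- rewrite lhs_fps_odd (_ : (N.*2.+1 == 2%N) = false); last lia.
  rewrite mulr0 add0r.
  rewrite [X in _ = X + _]big1 ?add0r; last first.
    by move=> m _; rewrite rhs_term1E /= odd_double.
  rewrite (trunc (fun j => rhs_term2 j.+1 N.*2.+1) _ N.+1); last 2 first.
  + lia.
  + by move=> j Nj; rewrite rhs_term2E [X in _ || X](_ : _ = true) ?orbT //; lia.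
  apply: eq_bigr => j _; rewrite rhs_term2E /= odd_double ltnS ltn_double.
  by rewrite ltnNge -ltnS ltn_ord subSS -doubleB doubleK.
case: N => [|N].
  by rewrite big_nat1 rhs_term1E big_nat1 rhs_term2E mulr0 !addr0.
rewrite doubleS lhs_fps_even.
rewrite [X in _ = _ + (_ + X)]big1 ?addr0; last first.
  by move=> m _; rewrite rhs_term2E /= negbK odd_double.
rewrite (trunc (fun j => rhs_term1 j.+1 N.*2.+2) _ N.+1); last 2 first.
- lia.
- by move=> j Nj; rewrite rhs_term1E [X in _ || X](_ : _ = true) ?orbT //; lia.
have -> : \sum_(j < N.+1) rhs_term1 j.+1 N.*2.+2 =
    \sum_(j < N.+1) inv_series pole j.+1 (N - j)%N * (j`! * j.+1`!)%N%:R.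
  apply: eq_bigr => j _; rewrite rhs_term1E /= negbK odd_double !ltnS ltn_double.
  by rewrite ltnNge -ltnS ltn_ord !subSS -doubleB doubleK.
rewrite (@sum_inv_seriesS _ _ (fun j => (j`! * j.+1`!)%N%:R)).
(* The factor (j+1)(j+2) of [pole j.+1] turns j!(j+1)! into (j+1)!(j+2)!, giving the same sum
   without its term j = 0. That term is 1 exactly for N = 0, which accounts for the correction
   (y-1)t^2. *)
have -> : \sum_(j < N) pole j.+1 * inv_series pole j.+1 (N - j.+1)%N * (j`! * j.+1`!)%N%:R
   = (1 - yv) * (\sum_(j < N.+1) inv_series pole j (N - j)%N * (j`! * j.+1`!)%N%:R
                 - (N == 0%N)%:R).
  rewrite [in RHS]big_ord_recl [inv_series _ ord0 _](_ : _ = (N == 0%N)%:R).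
    rewrite [(ord0`! * _)%N](_ : _ = 1%N) // mulr1 addrAC subrr add0r mulr_sumr.
    apply: eq_bigr => j _; rewrite lift0 /pole.
    by rewrite [j.+2`!]factS [in RHS]factS !natrM; ring.
  by rewrite subn0.
have -> : (N.*2.+2 == 2%N) = (N == 0%N) by case: N.
set S := \sum_(j < _) _; ring.
Qed.
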